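(* Let $\phi:\mathbb{P}^1\to\mathbb{P}^1$ be a rational map defined over a global function field $K$ with exactly one prime of bad reduction, and let $\mathcal{C}\subset\mathbb{P}^1(K)$ be a cycle of $\phi$ of length $n>1$. Then for every fixed prime $\mathfrak p$ of $K$ at which $\phi$ has good reduction, the quantity $\delta_{\mathfrak p}(P,Q)$ is the same for all pairs $(P,Q)$ of distinct points of $\mathcal{C}$.
   Context: A global function field is a finite extension of $\mathbb{F}_p(t)$; its primes are its places, each with a discrete valuation $v_{\mathfrak p}$, valuation ring $R_{\mathfrak p}$, maximal ideal $\mathfrak p$. Write $\phi([X:Y])=[F:G]$ with $F,G$ coprime homogeneous polynomials over $K$ of degree $\deg\phi$; for a prime $\mathfrak p$, scale so all coefficients lie in $R_{\mathfrak p}$ and not all in $\mathfrak p$; $\phi$ has good reduction at $\mathfrak p$ if the homogeneous resultant $\mathrm{Res}(F,G)$ is a unit of $R_{\mathfrak p}$, and bad reduction otherwise. The $\mathfrak p$-adic logarithmic distance of $P_1=[x_1:y_1],P_2=[x_2:y_2]$ is $\delta_{\mathfrak p}(P_1,P_2)=v_{\mathfrak p}(x_1y_2-x_2y_1)-\min\{v_{\mathfrak p}(x_1),v_{\mathfrak p}(y_1)\}-\min\{v_{\mathfrak p}(x_2),v_{\mathfrak p}(y_2)\}$. A cycle is the forward orbit $\{\phi^i(P):i\geqslant0\}$ of a periodic point $P$; its length is its cardinality. *)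

(* Defs.v *)
From HB Require Import structures.
From mathcomp Require Import all_boot all_order all_algebra all_field.
From mathcomp Require Import fraction.
Set Implicit Arguments. Unset Strict Implicit. Unset Printing Implicit Defensive.
Import Order.TTheory GRing.Theory Num.Theory.
Local Open Scope ring_scope.

Definition Fpt (p : nat) := {fraction {poly 'F_p}}.

Section Defs.
Variable K : fieldType.

(* A prime (place) of K, given by its normalized discrete valuation
   v : K^* ->> Z (the value at 0 is fixed to 0 by convention and never used
   as a genuine valuation value: v 0 = +oo is handled explicitly below). *)
Record dval := DVal {
  dv :> K -> int;
  dv0 : dv 0 = 0;
  dvM : forall x y, x != 0 -> y != 0 -> dv (x * y) = dv x + dv y;
  dvD : forall x y, x != 0 -> y != 0 -> x + y != 0 ->
          Num.min (dv x) (dv y) <= dv (x + y);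
  dv_surj : exists x : K, dv x = 1
}.

Definition inR (v : dval) (x : K) : bool := (x == 0) || (0 <= v x).
Definition unitR (v : dval) (x : K) : bool := (x != 0) && (v x == 0).
Definition inMax (v : dval) (x : K) : bool := (x == 0) || (0 < v x).

(* A homogeneous form of degree d in (X,Y) is encoded by a polynomial f with
   size f <= d.+1:  F(X,Y) = \sum_i f_i X^i Y^(d-i). *)
Definition hev (d : nat) (f : {poly K}) (x y : K) : K :=
  \sum_(i < d.+1) f`_i * x ^+ i * y ^+ (d - i).

(* Sylvester matrix of two binary forms of degree d; its determinant is
   (up to sign) the homogeneous resultant Res(F,G). *)
Definition hsylv (d : nat) (f g : {poly K}) : 'M[K]_(d + d) :=
  \matrix_(i < d + d, j < d + d)
    if (i < d)%N then
      (if ((i <= j) && (j <= i + d))%N then f`_(j - i) else 0)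
    else
      (if ((i - d <= j) && (j <= i - d + d))%N then g`_(j - (i - d)) else 0).

Definition hres (d : nat) (f g : {poly K}) : K := \det (hsylv d f g).

Definition good_red (v : dval) (d : nat) (f g : {poly K}) : Prop :=
  exists c : K, [/\ c != 0,
    (forall i, (i <= d)%N -> inR v (c * f`_i) /\ inR v (c * g`_i)),
    ~ (forall i, (i <= d)%N -> inMax v (c * f`_i) /\ inMax v (c * g`_i))
    & unitR v (hres d (c *: f) (c *: g))].

Definition phi (d : nat) (f g : {poly K}) (P : K * K) : K * K :=
  (hev d f P.1 P.2, hev d g P.1 P.2).

(* equality of points of P^1 given by nonzero representatives *)
Definition peq (P Q : K * K) : bool := P.1 * Q.2 == Q.1 * P.2.

(* min{v(x), v(y)} with v(0) = +oo, for (x,y) != (0,0) *)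
Definition minv (v : dval) (P : K * K) : int :=
  if P.1 == 0 then v P.2 else if P.2 == 0 then v P.1
  else Num.min (v P.1) (v P.2).

Definition delta (v : dval) (P Q : K * K) : int :=
  v (P.1 * Q.2 - Q.1 * P.2) - minv v P - minv v Q.

End Defs.

(* Main.v *)
(* Write [ij] for the bracket of the points P_i and P_j of the cycle. At a
   place of good reduction the map does not decrease the logarithmic distance,
   so along a cycle delta(P_i, P_j) depends only on j - i. Hence the cross-ratios
   r_k = [k,k+1][k+2,k+3] / ([k,k+2][k+1,k+3]) have the valuation
   2 (delta_1 - delta_2) at every good place. The elements
   g_k = [0,k+1]/[01] * prod_(i < k) [i,i+1]/[i,i+2] satisfy g_0 = g_1 = 1 and
   the frieze recurrence g_(k+2) = g_(k+1) - r_k g_k.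
   An element of K whose valuations vanish at all places but one is a constant,
   because a nonconstant has both a zero and a pole. So all the r_k have the same
   valuation at every place; were it positive somewhere, all g_k would be units
   there, whereas closing the cycle gives 2 v(g_(n-2)) = (n-2) v(r_0). Hence r_0
   has no zero, so it is constant, the g_k are integral everywhere, hence
   constant, and v(g_k) = 0 reads delta_(k+1) = delta_1 at the good places. *)
Require Import Defs.
From HB Require Import structures.
From mathcomp Require Import all_boot all_order all_algebra all_field.
From mathcomp Require Import fraction ring zify boolp classical_sets.
Set Implicit Arguments. Unset Strict Implicit. Unset Printing Implicit Defensive.
Import Order.TTheory GRing.Theory Num.Theory.
Local Open Scope ring_scope.

(** * Discrete valuations *)

Section DiscreteValuation.
Variables (K : fieldType) (v : dval K).
Implicit Types (x y : K) (P Q : K * K).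

Lemma val1 : v 1 = 0.
Proof.
by have := dvM v (oner_neq0 K) (oner_neq0 K); rewrite mulr1 -[LHS]addr0 => /addrI.
Qed.

Lemma valV x : v x^-1 = - v x.
Proof.
have [->|x0] := eqVneq x 0; first by rewrite invr0 (dv0 v) oppr0.
by apply/eqP; rewrite -addr_eq0 -dvM ?invr_eq0 // mulVf // val1.
Qed.

Lemma valX x m : v (x ^+ m) = v x *+ m.
Proof.
have [->|x0] := eqVneq x 0.
  by case: m => [|m]; rewrite ?expr0 ?val1 // expr0n /= (dv0 v) mul0rn.
elim: m => [|m IH]; first by rewrite expr0 val1.
by rewrite exprS dvM ?expf_neq0 // IH mulrS.
Qed.

Lemma valN x : v (- x) = v x.
Proof.
have [->|x0] := eqVneq x 0; first by rewrite oppr0.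
have vN1 : v (-1) = 0.
  have := valX (-1) 2; rewrite sqrrN expr1n val1; lia.
by rewrite -mulN1r dvM ?oppr_eq0 ?oner_eq0 // vN1 add0r.
Qed.

Lemma torsion_val0 x m : (0 < m)%N -> x ^+ m = 1 -> v x = 0.
Proof. by move=> m0 xm; have := valX x m; rewrite xm val1; nia. Qed.

Lemma val_prod (I : Type) (r : seq I) (h : I -> K) :
  (forall i, h i != 0) -> v (\prod_(i <- r) h i) = \sum_(i <- r) v (h i).
Proof.
move=> h0; elim: r => [|i r IH]; first by rewrite !big_nil val1.
rewrite !big_cons dvM ?IH //.
by elim/big_ind: _ => [|a b|j _]; rewrite ?oner_neq0 //; apply: mulf_neq0.
Qed.

Lemma inR_subring : subring_closed (inR v).
Proof.
split=> [|x y|x y]; rewrite -!topredE /= /inR ?val1 ?lexx ?orbT //.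
- have [->|x0] := eqVneq x 0; first by rewrite sub0r oppr_eq0 valN.
  have [->|y0] := eqVneq y 0; first by rewrite subr0 (negPf x0).
  case: eqVneq => //= xy0 vx vy; have := dvD v x0 _ xy0.
  by rewrite oppr_eq0 valN => /(_ y0); apply: le_trans; rewrite le_min vx.
- have [->|x0] := eqVneq x 0; first by rewrite mul0r eqxx.
  have [->|y0] := eqVneq y 0; first by rewrite mulr0 eqxx.
  by rewrite mulf_eq0 (negPf x0) (negPf y0) /= dvM //; apply: addr_ge0.
Qed.

HB.instance Definition _ := GRing.isSubringClosed.Build K (inR v) inR_subring.

Lemma inMaxW x : inMax v x -> x \in inR v.
Proof. by case/orP=> h; rewrite -topredE /= /inR ?h // ltW ?orbT. Qed.

Lemma inMaxM x y : x \in inR v -> inMax v y -> inMax v (x * y).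
Proof.
rewrite -topredE /= /inR /inMax mulf_eq0.
have [//|x0] := eqVneq x 0; have [//|y0] /= := eqVneq y 0.
by rewrite dvM //; lia.
Qed.

Lemma inMaxD x y : inMax v x -> inMax v y -> inMax v (x + y).
Proof.
rewrite /inMax; have [->|x0] := eqVneq x 0; first by rewrite add0r.
have [->|y0] := eqVneq y 0; first by rewrite addr0 (negPf x0).
have [//|xy0] := eqVneq (x + y) 0 => /= vx vy.
by apply: lt_le_trans (dvD v x0 y0 xy0); rewrite lt_min vx.
Qed.

Lemma inMax_sum (I : Type) (r : seq I) (S : pred I) (h : I -> K) :
  (forall i, S i -> inMax v (h i)) -> inMax v (\sum_(i <- r | S i) h i).
Proof.
by move=> hM; elim/big_ind: _ => //; [rewrite /inMax eqxx|apply: inMaxD].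
Qed.

Lemma inMaxX x m : inMax v (x ^+ m) -> inMax v x.
Proof.
case: m => [|m]; first by rewrite /inMax expr0 oner_eq0 val1.
by rewrite /inMax expf_eq0 /= valX; case: eqP => //= _; nia.
Qed.

Lemma unitRP x : reflect (x != 0 /\ v x = 0) (unitR v x).
Proof. by apply: (iffP andP) => -[x0] /eqP. Qed.

Lemma unitR_notMax x : x \in inR v -> ~~ inMax v x = unitR v x.
Proof.
by rewrite -topredE /= /inR /inMax /unitR; case: eqP => //= _; lia.
Qed.

Lemma unitR_near1 x : inMax v (x - 1) -> unitR v x.
Proof.
move=> x1; have xR : x \in inR v by rewrite -[x](subrK 1) rpredD ?rpred1 ?inMaxW.
rewrite -unitR_notMax //; apply/negP => xM.
have : inMax v (x + (-1) * (x - 1)) by rewrite inMaxD ?inMaxM // rpredN1.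
by rewrite mulN1r opprB addrC subrK /inMax oner_eq0 val1.
Qed.

Lemma inMax_unitM u x : unitR v u -> inMax v (u * x) = inMax v x.
Proof.
case/unitRP=> u0 vu; rewrite /inMax mulf_eq0 (negPf u0) /=.
by case: (eqVneq x 0) => //= x0; rewrite dvM // vu add0r.
Qed.

End DiscreteValuation.

(** * Logarithmic distance and good reduction *)

Section ProjectiveLine.
Variable K : fieldType.
Implicit Types (v : dval K) (P Q : K * K) (f g : {poly K}).

Definition scale (a : K) P : K * K := (a * P.1, a * P.2).

Lemma scaleA a b P : scale a (scale b P) = scale (a * b) P.
Proof. by rewrite /scale /= !mulrA. Qed.

Lemma scale_neq0 a P : a != 0 -> P != (0, 0) -> scale a P != (0, 0).
Proof.
by move=> a0; rewrite /scale !xpair_eqE !mulf_eq0 (negPf a0).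
Qed.

Definition brk P Q : K := P.1 * Q.2 - Q.1 * P.2.

Lemma brkN P Q : brk Q P = - brk P Q.
Proof. by rewrite /brk opprB. Qed.

Lemma peqE P Q : peq P Q = (brk P Q == 0).
Proof. by rewrite /peq /brk subr_eq0. Qed.

Lemma peq_refl P : peq P P. Proof. by rewrite /peq. Qed.

Lemma peq_sym P Q : peq P Q = peq Q P.
Proof. by rewrite /peq eq_sym. Qed.

Lemma peq_scale P Q : P != (0, 0) -> Q != (0, 0) -> peq P Q ->
  exists2 a, a != 0 & Q = scale a P.
Proof.
case: P Q => [x y] [z t]; rewrite !xpair_eqE !negb_and /peq /scale /=.
have [->|x0] /= := eqVneq x 0 => [y0|_].
  move=> + /eqP; rewrite mul0r => + /esym/eqP.
  rewrite mulf_eq0 (negPf y0) orbF => + /eqP z0.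
  rewrite z0 eqxx /= => t0; exists (t / y); first by rewrite mulf_neq0 ?invr_eq0.
  by rewrite mulr0 divfK.
move=> zt /eqP e; have et : t = z / x * y.
  by apply: (mulfI x0); rewrite e; field.
exists (z / x); last by rewrite divfK // -et.
rewrite mulf_neq0 ?invr_eq0 //; apply: contraL zt => /eqP z0.
by rewrite et z0 !mul0r eqxx.
Qed.

Lemma brk_scale a b P Q : brk (scale a P) (scale b Q) = a * b * brk P Q.
Proof. by rewrite /brk /=; ring. Qed.

Lemma minv_scale v a P : a != 0 -> P != (0, 0) ->
  minv v (scale a P) = v a + minv v P.
Proof.
move=> a0; case: P => x y; rewrite xpair_eqE negb_and /minv /=.
rewrite !mulf_eq0 (negPf a0) /=.
have [_|x0] /= := eqVneq x 0; first by move=> y0; rewrite dvM.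
have [_|y0] /= := eqVneq y 0; first by rewrite dvM.
by rewrite !dvM //; lia.
Qed.

Lemma delta_scale v a b P Q : a != 0 -> b != 0 ->
  P != (0, 0) -> Q != (0, 0) -> ~~ peq P Q ->
  delta v (scale a P) (scale b Q) = delta v P Q.
Proof.
move=> a0 b0 P0 Q0; rewrite peqE => PQ.
rewrite /delta -!/(brk _ _) brk_scale !minv_scale // !dvM ?mulf_neq0 //.
lia.
Qed.

Lemma deltaC v P Q : delta v P Q = delta v Q P.
Proof. by rewrite /delta -!/(brk _ _) brkN valN; lia. Qed.

Lemma delta_peq v P P' Q Q' :
  P != (0, 0) -> Q != (0, 0) -> P' != (0, 0) -> Q' != (0, 0) ->
  peq P P' -> peq Q Q' -> ~~ peq P Q -> delta v P' Q' = delta v P Q.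
Proof.
move=> P0 Q0 P'0 Q'0 /(peq_scale P0 P'0)[a a0 ->] /(peq_scale Q0 Q'0)[b b0 ->].
exact: delta_scale.
Qed.

Definition primitive v P := [/\ P.1 \in inR v, P.2 \in inR v &
  ~ (inMax v P.1 /\ inMax v P.2)].

Lemma primitive_neq0 v P : primitive v P -> P != (0, 0).
Proof. by case=> _ _ nM; apply/eqP => P0; apply: nM; rewrite P0 /inMax eqxx. Qed.

Lemma primitive_minv v P : primitive v P -> minv v P = 0.
Proof.
case: P => x y [] /=; rewrite -!topredE /= /inR /inMax /minv /=.
by have [->|x0] := eqVneq x 0; have [->|y0] := eqVneq y 0 => //=; try lia.
Qed.

Lemma primitive_exists v P : P != (0, 0) ->
  exists2 a, a != 0 & primitive v (scale a P).
Proof.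
case: P => x y; rewrite xpair_eqE negb_and => xy0.
suff [z z0 zm] : exists2 z, z != 0 & minv v (x, y) = v z.
  exists z^-1; first by rewrite invr_eq0.
  rewrite /primitive -!topredE /= /inR /inMax !mulf_eq0 invr_eq0 (negPf z0) /=.
  move: zm xy0; rewrite /minv /=.
  have [->|x0] := eqVneq x 0; have [->|y0] := eqVneq y 0 => //= e _;
    rewrite ?dvM ?invr_eq0 ?valV //; split => //; lia.
rewrite /minv /=; have [x0|x0] := eqVneq x 0.
  by exists y => //; move: xy0; rewrite x0 eqxx.
have [y0|y0] := eqVneq y 0; first by exists x.
by case: (lerP (v x) (v y)) => _; [exists x|exists y].
Qed.

Section Forms.
Variable d : nat.

Lemma hev_scale f a x y : hev d f (a * x) (a * y) = a ^+ d * hev d f x y.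
Proof.
rewrite /hev mulr_sumr; apply: eq_bigr => i _; rewrite !exprMn.
have -> : a ^+ d = a ^+ i * a ^+ (d - i) by rewrite -exprD subnKC // -ltnS.
ring.
Qed.

Lemma hevZ c f x y : hev d (c *: f) x y = c * hev d f x y.
Proof.
by rewrite /hev mulr_sumr; apply: eq_bigr => i _; rewrite coefZ !mulrA.
Qed.

Lemma phi_scale f g a P : phi d f g (scale a P) = scale (a ^+ d) (phi d f g P).
Proof. by rewrite /phi /scale /= !hev_scale. Qed.

Lemma phiZ c f g P : phi d (c *: f) (c *: g) P = scale c (phi d f g P).
Proof. by rewrite /phi /scale /= !hevZ. Qed.

Lemma phi_peq f g P Q : P != (0, 0) -> Q != (0, 0) -> peq P Q ->
  peq (phi d f g P) (phi d f g Q).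
Proof.
by move=> P0 Q0 /(peq_scale P0 Q0)[a _ ->]; rewrite phi_scale /peq /=; apply/eqP; ring.
Qed.

Lemma sum_shift (i : nat) (a m : nat -> K) : (i < d)%N ->
  \sum_(j < d + d) (if (i <= j)%N && (j <= i + d)%N then a (j - i)%N else 0) * m j
  = \sum_(l < d.+1) a l * m (i + l)%N.
Proof.
move=> id.
rewrite -(big_mkord xpredT (fun j => (if (i <= j)%N && (j <= i + d)%N
  then a (j - i)%N else 0) * m j)) (big_cat_nat (n := i)) /=; [|lia..].
rewrite [X in X + _ = _]big_nat [X in X + _ = _]big1 ?add0r; last first.
  by move=> j jd; rewrite ifF ?mul0r //; lia.
rewrite (big_cat_nat (n := (d.+1 + i)%N)) /=; [|lia..].
rewrite [X in _ + X = _]big_nat [X in _ + X = _]big1 ?addr0; last first.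
  by move=> j jd; rewrite ifF ?mul0r //; lia.
rewrite -{1}[i]add0n big_addn addnK big_mkord; apply: eq_bigr => l _.
by rewrite addnK leq_addl addnC leq_add2l -ltnS ltn_ord.
Qed.

Definition monomials (x y : K) : 'cV[K]_(d + d) :=
  \col_j (x ^+ j * y ^+ (d + d - j.+1)).

(* The rows of the Sylvester matrix are the forms x^i y^(d-1-i) f and
   x^i y^(d-1-i) g written in the monomials of degree 2d-1. *)
Lemma hsylv_monomials f g x y i :
  (hsylv d f g *m monomials x y) i 0 =
  let k := if (i < d)%N then val i else (i - d)%N in
  x ^+ k * y ^+ (d - k.+1) * (if (i < d)%N then hev d f x y else hev d g x y).
Proof.
have aux (h : {poly K}) k : (k < d)%N ->
  \sum_(j < d + d) (if (k <= j)%N && (j <= k + d)%N then h`_(j - k) else 0)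
     * (x ^+ j * y ^+ (d + d - j.+1)) = x ^+ k * y ^+ (d - k.+1) * hev d h x y.
  move=> kd; rewrite (sum_shift (fun l => h`_l) (fun j => x ^+ j * y ^+ (d + d - j.+1)) kd).
  rewrite /hev mulr_sumr; apply: eq_bigr => l _; rewrite exprD.
  have -> : (d + d - (k + l).+1 = (d - k.+1) + (d - l))%N by have := ltn_ord l; lia.
  by rewrite exprD; ring.
rewrite mxE /=; case: ifP => id.
  rewrite -aux //; apply: eq_bigr => j _; rewrite !mxE id; by [].
rewrite -aux; last by have := ltn_ord i; lia.
by apply: eq_bigr => j _; rewrite !mxE id.
Qed.

Lemma hres_monomials f g x y :
  hres d f g *: monomials x y = \adj (hsylv d f g) *m (hsylv d f g *m monomials x y).
Proof. by rewrite mulmxA mul_adj_mx mul_scalar_mx. Qed.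

Lemma phi_neq0 f g P : (0 < d)%N -> hres d f g != 0 -> P != (0, 0) -> phi d f g P != (0, 0).
Proof.
case: P => x y d_gt0 res0; apply: contraNneq => -[/= fP gP].
have : hres d f g *: monomials x y = 0.
  rewrite hres_monomials (_ : _ *m monomials x y = 0) ?mulmx0 //.
  apply/matrixP => i j; rewrite ord1 hsylv_monomials fP gP mxE /=.
  by case: ifP; rewrite mulr0.
move/eqP; rewrite scaler_eq0 (negPf res0) /= => /eqP/matrixP mon0.
have h0 : (0 < d + d)%N by lia. have h1 : ((d + d).-1 < d + d)%N by lia.
have := mon0 (Ordinal h0) 0; have := mon0 (Ordinal h1) 0.
rewrite !mxE /= prednK // subnn !expr0 mul1r mulr1 => /eqP + /eqP.
rewrite !expf_eq0 => /andP[_ /eqP ->] /andP[_ /eqP ->]; by [].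
Qed.

Section GoodReduction.
Variables (v : dval K) (f g : {poly K}).
Hypotheses (fR : forall i, (i <= d)%N -> f`_i \in inR v)
           (gR : forall i, (i <= d)%N -> g`_i \in inR v).

Lemma hev_inR (h : {poly K}) x y : (forall i, (i <= d)%N -> h`_i \in inR v) ->
  x \in inR v -> y \in inR v -> hev d h x y \in inR v.
Proof.
move=> hR xR yR; apply: rpred_sum => i _.
by rewrite !rpredM ?rpredX ?hR // -ltnS.
Qed.

Lemma phi_primitive P : (0 < d)%N -> unitR v (hres d f g) ->
  primitive v P -> primitive v (phi d f g P).
Proof.
move=> d_gt0 res_unit; case: P => x y [/= xR yR nM]; split; rewrite ?hev_inR //= => -[fM gM].
have sM i : inMax v ((hsylv d f g *m monomials x y) i 0).
  by rewrite hsylv_monomials; apply: inMaxM; rewrite ?rpredM ?rpredX //; case: ifP.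
have sR i j : hsylv d f g i j \in inR v.
  rewrite mxE; case: ifP => _; case: ifP => h; rewrite ?rpred0 ?fR ?gR //; lia.
have mM j : inMax v (monomials x y j 0).
  rewrite -(inMax_unitM _ res_unit).
  have := congr1 (fun A : 'cV_(d + d) => A j 0) (hres_monomials f g x y).
  rewrite [LHS]mxE [RHS]mxE => ->; apply: inMax_sum => i _; apply: inMaxM => //.
  rewrite mxE /cofactor rpredM ?rpredX ?rpredN1 //.
  apply: rpred_sum => s _; rewrite rpredM ?rpredX ?rpredN1 //.
  by apply: rpred_prod => k _; rewrite mxE mxE; apply: sR.
have h0 : (0 < d + d)%N by lia. have h1 : ((d + d).-1 < d + d)%N by lia.
have := mM (Ordinal h0); have := mM (Ordinal h1).
by rewrite !mxE /= prednK // subnn !expr0 mul1r mulr1 => /inMaxX xM /inMaxX yM; apply: nM.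
Qed.

Lemma subrX_div (a b : K) k : a - b != 0 -> a \in inR v -> b \in inR v ->
  (a ^+ k - b ^+ k) / (a - b) \in inR v.
Proof.
move=> ab0 aR bR; rewrite subrXX mulrAC divff // mul1r.
by apply: rpred_sum => i _; rewrite rpredM ?rpredX.
Qed.

Lemma brk_phi_div P Q : brk P Q != 0 -> primitive v P -> primitive v Q ->
  brk (phi d f g P) (phi d f g Q) / brk P Q \in inR v.
Proof.
case: P Q => x y [z t] PQ0 [/= xR yR _] [/= zR tR _].
pose m i j := (x ^+ i * y ^+ (d - i)) * (z ^+ j * t ^+ (d - j)).
have mR i j : (i <= d)%N -> (j <= d)%N -> (m i j - m j i) / brk (x, y) (z, t) \in inR v.
  wlog ij : i j / (j <= i)%N => [wl|] id jd.
    case/orP: (leq_total j i) => ij; first exact: wl.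
    by rewrite -opprB mulNr rpredN wl.
  have -> : (m i j - m j i) = (x * z) ^+ j * (y * t) ^+ (d - i) *
     ((x * t) ^+ (i - j) - (z * y) ^+ (i - j)).
    rewrite /m !exprMn.
    have -> : (d - j = (d - i) + (i - j))%N by lia.
    have -> : x ^+ i = x ^+ j * x ^+ (i - j) by rewrite -exprD subnKC.
    have -> : z ^+ i = z ^+ j * z ^+ (i - j) by rewrite -exprD subnKC.
    rewrite !exprD; ring.
  rewrite -mulrA; apply: rpredM; first by rewrite !(rpredM, rpredX).
  by apply: subrX_div => //; apply: rpredM.
have -> : brk (phi d f g (x, y)) (phi d f g (z, t)) =
  \sum_(i < d.+1) \sum_(j < d.+1) f`_i * g`_j * (m i j - m j i).
  rewrite /brk /= /hev !mulr_suml -sumrB; apply: eq_bigr => i _.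
  rewrite !mulr_sumr -sumrB; apply: eq_bigr => j _.
  by rewrite /m; ring.
rewrite mulr_suml; apply: rpred_sum => i _; rewrite mulr_suml.
apply: rpred_sum => j _; rewrite -(mulrA (f`_i * _)); apply: rpredM.
  by rewrite rpredM ?fR ?gR // -ltnS.
by apply: mR; rewrite -ltnS.
Qed.

End GoodReduction.

Lemma delta_phi_le v f g P Q : (0 < d)%N -> good_red v d f g ->
  P != (0, 0) -> Q != (0, 0) -> ~~ peq (phi d f g P) (phi d f g Q) ->
  delta v P Q <= delta v (phi d f g P) (phi d f g Q).
Proof.
move=> d_gt0 [c [c0 cR _ resU]] P0 Q0 fPQ.
have fR i : (i <= d)%N -> (c *: f)`_i \in inR v by move=> /cR[]; rewrite coefZ.
have gR i : (i <= d)%N -> (c *: g)`_i \in inR v by move=> /cR[_]; rewrite coefZ.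
have [a a0 aP] := primitive_exists v P0; have [b b0 bQ] := primitive_exists v Q0.
have PQ : ~~ peq P Q by apply: contra fPQ; apply: phi_peq.
have pP := phi_primitive fR gR d_gt0 resU aP; have pQ := phi_primitive fR gR d_gt0 resU bQ.
have nz P' a' : a' != 0 -> P' != (0, 0) ->
    primitive v (phi d (c *: f) (c *: g) (scale a' P')) -> phi d f g P' != (0, 0).
  move=> a'0 P'0 /primitive_neq0; rewrite phiZ phi_scale.
  by apply: contraNneq => ->; rewrite /scale /= !mulr0.
have fP0 := nz _ _ a0 P0 pP; have fQ0 := nz _ _ b0 Q0 pQ.
have PQ' : brk (scale a P) (scale b Q) != 0.
  by rewrite brk_scale !mulf_neq0 // -peqE.
have := brk_phi_div fR gR PQ' aP bQ.
have fPQ' : brk (phi d (c *: f) (c *: g) (scale a P))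
                (phi d (c *: f) (c *: g) (scale b Q)) != 0.
  by rewrite !phiZ !phi_scale !brk_scale !mulf_neq0 ?expf_neq0 // -peqE.
rewrite -topredE /= /inR mulf_eq0 invr_eq0 (negPf fPQ') (negPf PQ') /=.
rewrite dvM ?invr_eq0 // valV subr_ge0.
have -> : delta v P Q = v (brk (scale a P) (scale b Q)).
  rewrite -(delta_scale v a0 b0 P0 Q0 PQ) /delta -/(brk _ _).
  by rewrite !primitive_minv // !subr0.
rewrite -(delta_scale v (a := c * a ^+ d) (b := c * b ^+ d) _ _ fP0 fQ0 fPQ) ?mulf_neq0 ?expf_neq0 //.
rewrite /delta -!/(brk _ _) -!scaleA -!phi_scale -!phiZ !primitive_minv //.
by rewrite !subr0.
Qed.

End Forms.
End ProjectiveLine.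

(** * Existence of places *)

Section MaximalSubring.
Variables (K : fieldType).
Implicit Types (A B : set K) (a b c x y z : K) (h k : {poly K}).

Record subring B : Prop := Subring {
  subring1 : B 1;
  subringB : forall a b, B a -> B b -> B (a - b);
  subringM : forall a b, B a -> B b -> B (a * b)
}.

Section Closure.
Variables (B : set K) (rB : subring B).

Lemma subring0 : B 0. Proof. by rewrite -(subrr 1); apply: (subringB rB); apply: subring1. Qed.
Lemma subringN a : B a -> B (- a).
Proof. by rewrite -sub0r; apply: (subringB rB); apply: subring0. Qed.
Lemma subringD a b : B a -> B b -> B (a + b).
Proof. by move=> Ba Bb; rewrite -(opprK b); apply: (subringB rB) => //; apply: subringN. Qed.
Lemma subringX a n : B a -> B (a ^+ n).
Proof.
by move=> Ba; elim: n => [|n IH]; [apply: subring1|rewrite exprS; apply: subringM].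
Qed.
Lemma subring_sum (I : Type) (r : seq I) (S : pred I) (f : I -> K) :
  (forall i, S i -> B (f i)) -> B (\sum_(i <- r | S i) f i).
Proof. by move=> fB; elim/big_ind: _ => //; [apply: subring0|apply: subringD]. Qed.
Lemma subring_horner h y : (forall i, B h`_i) -> B y -> B h.[y].
Proof.
by move=> hB yB; rewrite horner_coef; apply: subring_sum => i _; apply: subringM => //; apply: subringX.
Qed.

End Closure.

Lemma maximal_subring A x : subring A -> ~ A x^-1 ->
  exists B, [/\ subring B, (A `<=` B)%classic, ~ B x^-1 &
    forall B', subring B' -> (B `<=` B')%classic -> ~ B' x^-1 -> (B' `<=` B)%classic].
Proof.
move=> rA Ax.
pose S B := [/\ forall b, B b -> (A `<=` B)%classic,
  forall a b, B a -> B b -> B (a - b), forall a b, B a -> B b -> B (a * b) & ~ B x^-1].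
have [|B [[BA sB mB Bx] maxB]] := @Zorn_bigcup K S.
  move=> F FS totF.
  have two a b : (\bigcup_(X in F) X)%classic a -> (\bigcup_(X in F) X)%classic b ->
      exists2 X, F X & X a /\ X b.
    move=> [X FX Xa] [Y FY Yb]; case: (totF X Y FX FY) => XY.
      by exists Y => //; split=> //; apply: XY.
    by exists X => //; split=> //; apply: XY.
  split.
  - by move=> b [X FX Xb] a Aa; exists X => //; case: (FS X FX) => h _ _ _; apply: (h b).
  - move=> a b Ua Ub; have [X FX [Xa Xb]] := two a b Ua Ub; exists X => //.
    by case: (FS X FX) => _ h _ _; apply: h.
  - move=> a b Ua Ub; have [X FX [Xa Xb]] := two a b Ua Ub; exists X => //.
    by case: (FS X FX) => _ _ h _; apply: h.
  - by move=> [X FX]; case: (FS X FX).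
have SA B' : subring B' -> (A `<=` B')%classic -> ~ B' x^-1 -> S B'.
  by move=> rB' AB' B'x; split=> // [a b|a b]; [apply: subringB|apply: subringM].
have [b Bb] : exists b, B b.
  apply: contrapT => B0; apply: (maxB A); last exact: SA.
  by split=> [b Bb|AB]; case: B0; [exists b|exists 1; apply: AB; apply: subring1].
have AB := BA b Bb; exists B; split=> //.
  by split=> //; apply: AB; apply: subring1.
move=> B' rB' BB' B'x; apply: contrapT => B'B.
by apply: (maxB B') => //; apply: SA => // a /AB; apply: BB'.
Qed.

Section Chevalley.
Variables (B : set K) (x : K) (rB : subring B).
Hypotheses (Bx : B x) (BVx : ~ B x^-1).
Hypothesis maxB : forall B', subring B' -> (B `<=` B')%classic -> ~ B' x^-1 ->
  (B' `<=` B)%classic.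

Lemma maximal_x_neq0 : x != 0.
Proof. by apply/eqP => x0; apply: BVx; rewrite x0 invr0; apply: subring0. Qed.
Let x0 := maximal_x_neq0.

(* x lies in the Jacobson radical: otherwise B[1/(1 + x b)] would be larger. *)
Lemma maximal_radical b : B b -> 1 + x * b != 0 /\ B (1 + x * b)^-1.
Proof.
move=> Bb; set u := 1 + x * b.
have u0 : u != 0.
  apply/eqP => u0; apply: BVx; have -> : x^-1 = - b; last exact: subringN.
  by apply: (mulfI x0); rewrite divff // mulrN; apply/eqP; rewrite -addr_eq0 -/u u0.
split=> //.
have Bu : B u by apply: subringD => //; [apply: subring1|apply: subringM].
pose B' z := exists m, B (z * u ^+ m).
have uX m : exists2 c, B c & u ^+ m = 1 + x * c.
  elim: m => [|m [c Bc e]]; first by exists 0; [apply: subring0|rewrite mulr0 addr0].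
  exists (c + b + x * c * b); last by rewrite exprSr e /u; ring.
  by do ?[apply: subringD => //]; do ?[apply: subringM => //].
apply: (maxB (B' := B')); last by exists 1%N; rewrite expr1 mulVf //; apply: subring1.
- split.
  + by exists 0%N; rewrite mulr1; apply: subring1.
  + move=> a c [m Bm] [k Bk]; exists (m + k)%N.
    have -> : (a - c) * u ^+ (m + k) = a * u ^+ m * u ^+ k - c * u ^+ k * u ^+ m.
      by rewrite exprD; ring.
    by apply: (subringB rB); apply: subringM => //; apply: subringX.
  + move=> a c [m Bm] [k Bk]; exists (m + k)%N.
    by rewrite exprD mulrACA; apply: subringM.
- by move=> z Bz; exists 0%N; rewrite mulr1.
- move=> [m]; have [c Bc ->] := uX m.
  rewrite mulrDr mulr1 mulKf // => Bxc; apply: BVx.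
  by rewrite -(addrK c x^-1); apply: (subringB rB).
Qed.

Definition unit_relation h y :=
  (forall i, exists2 b, B b & h`_i = x * b) /\ h.[y] = 1.

Lemma unit_relation_exists y : ~ B y -> exists h, unit_relation h y.
Proof.
move=> By; apply: contrapT => noh; apply: By.
pose B' z := exists2 h : {poly K}, (forall i, B h`_i) & z = h.[y].
have BC c i : B c -> B (c%:P)`_i.
  by rewrite coefC; case: ifP => // _ _; apply: subring0.
apply: (maxB (B' := B')).
- split.
  + by exists 1%:P; [move=> i; apply: BC; apply: subring1|rewrite hornerC].
  + move=> a b [h hB ->] [k kB ->]; exists (h - k); last by rewrite hornerD hornerN.
    by move=> i; rewrite coefB; apply: (subringB rB).
  + move=> a b [h hB ->] [k kB ->]; exists (h * k); last by rewrite hornerM.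
    by move=> i; rewrite coefM; apply: subring_sum => // j _; apply: subringM.
- by move=> z Bz; exists z%:P; [move=> i; apply: BC|rewrite hornerC].
- move=> [h hB e]; apply: noh; exists (x *: h); split.
    by move=> i; exists h`_i => //; rewrite coefZ.
  by rewrite hornerZ -e divff.
- exists 'X; last by rewrite hornerX.
  by move=> i; rewrite coefX; case: eqP => _; [apply: subring1|apply: subring0].
Qed.

Lemma unit_relation_descent h k y : y != 0 -> (size k <= size h)%N ->
  unit_relation h y -> unit_relation k y^-1 ->
  exists2 h' : {poly K}, (size h' < size h)%N & unit_relation h' y.
Proof.
move=> y0 kh [hB hy] [kB ky].
have [b Bb k0] := kB 0%N.
have [u0 BuV] := maximal_radical (subringN rB Bb).
set u := 1 + _ in u0 BuV.
have [n hn] : exists n, size h = n.+1.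
  exists (size h).-1; rewrite prednK // lt0n size_poly_eq0.
  by apply: contra_eq_neq hy => ->; rewrite horner0 eq_sym oner_eq0.
have uE : u = \sum_(i < n) k`_i.+1 * y^-1 ^+ i.+1.
  have := ky; rewrite (@horner_coef_wide _ n.+1); last by rewrite -hn.
  rewrite big_ord_recl expr0 mulr1 k0 /u => e.
  by rewrite -e mulrN addrAC addrN add0r.
exists (\poly_(i < n) (h`_i + h`_n * (k`_(n - i) / u))).
  by rewrite hn ltnS size_poly.
split.
  move=> i; rewrite coef_poly; case: ifP => _; last by exists 0; [apply: subring0|rewrite mulr0].
  have [a Ba ->] := hB i; have [c Bc ->] := hB n; have [e Be ->] := kB (n - i)%N.
  exists (a + c * (x * e / u)); last by ring.
  by apply: subringD => //; do ?apply: subringM => //.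
rewrite horner_poly -[RHS]hy horner_coef hn big_ord_recr /=.
under eq_bigr do rewrite mulrDl.
rewrite big_split /=; congr (_ + _).
under eq_bigr do rewrite -mulrA; rewrite -mulr_sumr; congr (_ * _).
apply: (mulIf u0); rewrite mulr_suml.
transitivity (\sum_(i < n) k`_(n - i) * y ^+ i).
  by apply: eq_bigr => i _; rewrite mulrAC divfK.
rewrite uE mulr_sumr (reindex_inj rev_ord_inj) /=; apply: eq_bigr => i _.
have -> : (n - (n - i.+1) = i.+1)%N by have := ltn_ord i; lia.
have -> : y ^+ n = y ^+ (n - i.+1) * y ^+ i.+1 by rewrite -exprD subnK.
by rewrite exprVn; field; rewrite expf_neq0.
Qed.

Lemma maximal_valuation_ring y : B y \/ B y^-1.
Proof.
have [->|y0] := eqVneq y 0; first by left; apply: subring0.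
apply: contrapT => /not_orP[By ByV].
have [h hy] := unit_relation_exists By; have [k ky] := unit_relation_exists ByV.
move: {2}(size h + size k)%N (leqnn (size h + size k)) => N.
elim: N y h k y0 By ByV hy ky => [|N IH] y h k y0 By ByV hy ky le.
  have : h = 0 by apply/eqP; rewrite -size_poly_eq0; lia.
  by case: hy => _ + h0; rewrite h0 horner0 => /eqP; rewrite eq_sym oner_eq0.
wlog kh : y h k y0 By ByV hy ky le / (size k <= size h)%N => [wl|].
  case/orP: (leq_total (size k) (size h)) => kh; first exact: (wl y h k).
  apply: (wl y^-1 k h) => //; rewrite ?invr_eq0 ?invrK //.
  by rewrite addnC.
have [h' h'h h'y] := unit_relation_descent y0 kh hy ky.
by apply: (IH y h' k) => //; lia.
Qed.

End Chevalley.
End MaximalSubring.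

Section Normalize.
Variables (K : fieldType) (f : K -> int).
Implicit Types x y : K.
Hypotheses (fM : forall x y, x != 0 -> y != 0 -> f (x * y) = f x + f y)
  (fD : forall x y, x != 0 -> y != 0 -> x + y != 0 -> Num.min (f x) (f y) <= f (x + y)).

Lemma val_exprz y (k : int) : y != 0 -> f (y ^ k) = k * f y.
Proof.
move=> y0; have f1 : f 1 = 0.
  by have := fM (oner_neq0 K) (oner_neq0 K); rewrite mulr1 -[LHS]addr0 => /addrI.
have fX m : f (y ^+ m) = m%:Z * f y.
  elim: m => [|m IH]; first by rewrite expr0 f1 mul0r.
  by rewrite exprS fM ?expf_neq0 // IH; lia.
case: k => m; first exact: fX.
rewrite NegzE -exprnN; have := fM (expf_neq0 m.+1 y0) (invr_neq0 (expf_neq0 m.+1 y0)).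
by rewrite divff ?expf_neq0 // f1 fX => h; apply/eqP; rewrite mulNr -addr_eq0 addrC -h.
Qed.

Lemma normalize_val : (exists2 y, y != 0 & 0 < f y) ->
  exists v : dval K, forall y, y != 0 -> (0 < v y) = (0 < f y).
Proof.
move=> [y1 y10 fy1].
pose p m := `[< exists2 y, y != 0 & f y = m.+1%:Z >].
have exp : exists m, p m.
  exists `|f y1|.-1%N; apply/asboolP; exists y1 => //; lia.
have [e /asboolP[y2 y20 fy2] emin] := ex_minnP exp.
have fdiv y : y != 0 -> exists q : int, f y = q * e.+1%:Z.
  move=> y0; set q := (f y %/ e.+1)%Z; exists q.
  have yq0 : y * y2 ^ (- q) != 0 by rewrite mulf_neq0 ?expfz_neq0.
  have fr : f (y * y2 ^ (- q)) = (f y %% e.+1)%Z.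
    rewrite fM ?expfz_neq0 // val_exprz // fy2 {1}(divz_eq (f y) e.+1) -/q; lia.
  have : (f y %% e.+1)%Z = 0.
    have := modz_ge0 (f y) (d := e.+1) isT; have := ltz_pmod (f y) (d := e.+1) isT.
    case: (modz _ _) fr => [[//|m]|//] fr lt _.
    suff : (e <= m)%N by lia.
    by apply: emin; apply/asboolP; exists (y * y2 ^ (- q)).
  by move=> r0; rewrite [LHS](divz_eq (f y) e.+1) r0 addr0.
pose w y := if y == 0 then 0 else (f y %/ e.+1)%Z.
have wE y : y != 0 -> f y = w y * e.+1%:Z.
  by move=> y0; have [q fq] := fdiv y y0; rewrite /w (negPf y0) fq mulzK.
have w0 : w 0 = 0 by rewrite /w eqxx.
have wM x y : x != 0 -> y != 0 -> w (x * y) = w x + w y.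
  move=> x0 y0; have := fM x0 y0; rewrite !wE ?mulf_neq0 //; nia.
have wD x y : x != 0 -> y != 0 -> x + y != 0 -> Num.min (w x) (w y) <= w (x + y).
  move=> x0 y0 xy0; have := fD x0 y0 xy0; rewrite !wE //; nia.
have w1 : exists y, w y = 1.
  by exists y2; have := wE _ y20; rewrite fy2; nia.
exists (DVal w0 wM wD w1) => y y0 /=; rewrite wE //; nia.
Qed.

End Normalize.

Section ValuationRing.
Variables (K : fieldType) (B : set K).
Hypotheses (rB : subring B) (tot : forall y, B y \/ B y^-1).

Definition isunit y := [/\ y != 0, B y & B y^-1].

Lemma isunit1 : isunit 1.
Proof. by split; rewrite ?oner_eq0 ?invr1 //; apply: subring1. Qed.

Lemma isunitM y z : isunit y -> isunit z -> isunit (y * z).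
Proof.
move=> [y0 By Byi] [z0 Bz Bzi]; split; rewrite ?mulf_neq0 ?invfM //; exact: subringM.
Qed.

Lemma isunitV y : isunit y -> isunit y^-1.
Proof. by move=> [y0 By Byi]; split; rewrite ?invr_eq0 ?invrK. Qed.

Lemma isunitX y m : isunit y -> isunit (y ^+ m).
Proof.
by move=> Uy; elim: m => [|m IH]; rewrite ?exprS; [apply: isunit1|apply: isunitM].
Qed.

Lemma isunit_factor y z : B y -> B z -> isunit (y * z) -> isunit y.
Proof.
move=> By Bz [yz0 _ Byz]; split=> //.
  by apply: contraNneq yz0 => ->; rewrite mul0r.
have z0 : z != 0 by apply: contraNneq yz0 => ->; rewrite mulr0.
by have := subringM rB Bz Byz; rewrite invfM mulrCA divff // mulr1.
Qed.

Lemma isunit_add y z : B y -> B z -> isunit (y + z) -> isunit y \/ isunit z.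
Proof.
move=> By Bz yz; have [y0|y0] := eqVneq y 0; first by right; rewrite y0 add0r in yz.
have [z0|z0] := eqVneq z 0; first by left; rewrite z0 addr0 in yz.
have B1 := subring1 rB; case: (tot (z / y)) => zy.
  left; apply: (isunit_factor (z := 1 + z / y)) => //; first exact: subringD.
  by rewrite mulrDr mulr1 mulrC divfK.
right; apply: (isunit_factor (z := 1 + y / z)) => //.
  by rewrite -invf_div; apply: subringD.
by rewrite mulrDr mulr1 [z * _]mulrC divfK // addrC.
Qed.

Definition assoc y z := isunit (y / z).

Lemma assoc_refl y : y != 0 -> assoc y y.
Proof. by move=> y0; rewrite /assoc divff //; apply: isunit1. Qed.

Lemma assoc_trans x y z : assoc x y -> assoc y z -> assoc x z.
Proof.
move=> xy yz; have := isunitM xy yz; rewrite mulrA divfK //.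
by case: yz; rewrite mulf_eq0 negb_or => /andP[].
Qed.

Lemma assocC y z : assoc y z -> assoc z y.
Proof. by move/isunitV; rewrite invf_div. Qed.

Lemma assoc_add y z : y != 0 -> z != 0 -> ~ assoc y z ->
  assoc (y + z) y \/ assoc (y + z) z.
Proof.
wlog zy : y z / B (z / y) => [wl|] y0 z0 nyz.
  case: (tot (z / y)) => h; first exact: wl.
  rewrite addrC; apply/or_comm; apply: wl => //; first by rewrite -invf_div.
  by move/assocC.
left; rewrite /assoc mulrDl divff //.
have B1 := subring1 rB; have Bs := subringD rB B1 zy.
have /isunit_add : isunit (1 + z / y - z / y) by rewrite addrK; apply: isunit1.
case=> //; first exact: subringN.
move=> U; case: nyz; apply: assocC; rewrite /assoc.
have -> : z / y = (-1) * - (z / y) by rewrite mulN1r opprK.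
apply: isunitM => //; split; rewrite ?oppr_eq0 ?oner_eq0 ?invrN1 //; exact: subringN.
Qed.

(* Terms of pairwise distinct valuations cannot cancel. *)
Lemma assoc_sum m (z : nat -> K) :
  (forall i j, (i < j < m)%N -> z i != 0 -> z j != 0 -> ~ assoc (z i) (z j)) ->
  (forall i, (i < m)%N -> z i = 0) \/
  exists i, [/\ (i < m)%N, z i != 0 & assoc (\sum_(j < m) z j) (z i)].
Proof.
elim: m => [|m IH] H; first by left.
have {}IH := IH (fun i j ij => H i j ltac:(lia)).
rewrite big_ord_recr /=; have [zm|zm] := eqVneq (z m) 0.
  case: IH => [z0|[i [im zi a]]]; [left|right].
    by move=> i; rewrite ltnS leq_eqVlt => /orP[/eqP->//|/z0].
  by exists i; rewrite zm addr0; split=> //; lia.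
right; case: IH => [z0|[i [im zi a]]].
  exists m; split=> //; rewrite big1 ?add0r; first exact: assoc_refl.
  by move=> i _; apply: z0.
have s0 : \sum_(j < m) z j != 0 by case: a; rewrite mulf_eq0 negb_or => /andP[].
have nsm : ~ assoc (\sum_(j < m) z j) (z m).
  move=> sm; apply: (H i m) => //; first by lia.
  exact: assoc_trans (assocC a) sm.
case: (assoc_add s0 zm nsm) => h; last by exists m.
by exists i; split=> //; [lia|apply: assoc_trans h a].
Qed.

Section Discrete.
Variables (pi : K) (N : nat).
Hypotheses (Bpi : B pi) (BVpi : ~ B pi^-1) (N_gt0 : (0 < N)%N).
Hypothesis disc : forall y, y != 0 -> exists k : int, assoc (y ^+ N) (pi ^ k).

Lemma uniformizer_neq0 : pi != 0.
Proof. by apply/eqP => pi0; apply: BVpi; rewrite pi0 invr0; apply: subring0. Qed.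
Let pi0 := uniformizer_neq0.

Lemma uniformizer_inR (k : int) : B (pi ^ k) <-> 0 <= k.
Proof.
split; last by case: k => // k _; apply: subringX.
case: k => // k; rewrite NegzE -exprnN -exprVn exprS => h; exfalso; apply: BVpi.
have := subringM rB h (subringX rB k Bpi); rewrite -mulrA -exprMn mulVf // expr1n mulr1.
by [].
Qed.

Lemma assoc_inR y z : assoc y z -> (B y <-> B z).
Proof.
move=> yz; have [yz0 B1 B2] := yz.
move: (yz0); rewrite mulf_eq0 invr_eq0 negb_or => /andP[y0 z0].
split=> h.
  by have := subringM rB h B2; rewrite invf_div mulrCA divff ?mulr1.
by have := subringM rB h B1; rewrite mulrCA divff ?mulr1.
Qed.

Lemma inR_expr y : B (y ^+ N) <-> B y.
Proof.
split=> [h|]; last exact: subringX.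
case: (tot y) => // By.
have [->|y0] := eqVneq y 0; first exact: subring0.
have := subringM rB h (subringX rB N.-1 By).
by rewrite -{1}(prednK N_gt0) exprS -mulrA -exprMn divff // expr1n mulr1.
Qed.

Lemma discrete_valuation : exists v : dval K,
  forall y, y != 0 -> B y -> ~ B y^-1 -> 0 < v y.
Proof.
pose f y := match pselect (y != 0) with
  | left y0 => projT1 (cid (disc y0)) | right _ => 0 end.
have fP y : y != 0 -> assoc (y ^+ N) (pi ^ f y).
  by move=> y0; rewrite /f; case: pselect => // ?; case: cid.
have fE y k : y != 0 -> assoc (y ^+ N) (pi ^ k) -> f y = k.
  move=> y0 h; have := assoc_trans (assocC (fP y y0)) h => u.
  have le (a b : int) : assoc (pi ^ a) (pi ^ b) -> b <= a.
    case=> _ + _; rewrite invr_expz -expfzDr // => /uniformizer_inR; lia.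
  apply/eqP; rewrite eq_le !le //; exact: assocC.
have f_ge0 y : y != 0 -> B y <-> 0 <= f y.
  by move=> y0; rewrite -inR_expr (assoc_inR (fP y y0)) uniformizer_inR.
have fM x y : x != 0 -> y != 0 -> f (x * y) = f x + f y.
  move=> x0 y0; apply: fE; first by rewrite mulf_neq0.
  rewrite exprMn expfzDr // /assoc invfM mulrACA.
  by apply: isunitM; apply: fP.
have fV y : y != 0 -> f y^-1 = - f y.
  move=> y0; have := fM y y^-1 y0; rewrite invr_eq0 divff // => /(_ y0).
  rewrite (fE 1 0) ?oner_eq0 //; first by lia.
  by rewrite expr1n expr0z; apply: assoc_refl; rewrite oner_eq0.
have fD x y : x != 0 -> y != 0 -> x + y != 0 -> Num.min (f x) (f y) <= f (x + y).
  wlog xy : x y / B (x / y) => [wl|] x0 y0 xy0.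
    case: (tot (x / y)) => h; first exact: wl.
    by rewrite addrC minC; apply: wl; rewrite 1?addrC // -invf_div.
  have : B ((x + y) / y) by rewrite mulrDl divff //; apply: subringD => //; apply: subring1.
  rewrite f_ge0 ?mulf_neq0 ?invr_eq0 // fM ?invr_eq0 // fV //; lia.
have f_gt0 y : y != 0 -> B y -> ~ B y^-1 -> 0 < f y.
  move=> y0 /(f_ge0 _ y0) fy; rewrite f_ge0 ?invr_eq0 // fV //; lia.
have [|v vf] := normalize_val fM fD; first by exists pi => //; apply: f_gt0.
by exists v => y y0 By Byi; rewrite vf // f_gt0.
Qed.

End Discrete.
End ValuationRing.

Lemma fractionP (R : idomainType) (c : {fraction R}) :
  exists a b : R, b != 0 /\ c = FracField.tofrac a / FracField.tofrac b.
Proof.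
elim/quotW: c => r; exists (frac r).1, (frac r).2; have r0 := denom_ratioP r.
split=> //; apply: (canRL (mulfK _)); first by rewrite tofrac_eq0.
unlock FracField.tofrac; rewrite -[LHS](FracField.pi_mul r).
by apply/eqmodP => /=; rewrite FracField.equivfE /FracField.mulf !numden_Ratio ?mulr1 ?mul1r ?oner_eq0 // mulrC.
Qed.

Section FunctionField.
Variables (p : nat) (K : fieldExtType (Fpt p)).
Implicit Types (f g h : {poly 'F_p}) (x y z pi : K).

Definition const_fun (f : {poly 'F_p}) : K := in_alg K (FracField.tofrac f : Fpt p).

HB.instance Definition _ := GRing.RMorphism.copy const_fun
  (in_alg K \o @FracField.tofrac {poly 'F_p}).

Lemma const_fun_eq0 f : (const_fun f == 0) = (f == 0).
Proof. by rewrite fmorph_eq0 tofrac_eq0. Qed.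

Lemma const_fun_frac (c : Fpt p) : exists a b,
  b != 0 /\ c%:A = const_fun a / const_fun b.
Proof.
have [a [b [b0 ->]]] := fractionP c; exists a, b; split=> //.
by rewrite -[LHS]/(in_alg K _) fmorph_div.
Qed.

Definition ev (x : K) (h : {poly 'F_p}) := (map_poly (const_fun \o polyC) h).[x].

HB.instance Definition _ x := GRing.RMorphism.copy (ev x)
  (horner_eval x \o map_poly (const_fun \o polyC)).

Lemma evX x : ev x 'X = x. Proof. by rewrite /ev map_polyX hornerX. Qed.

Lemma ev_subring x : subring [set z | exists h, z = ev x h]%classic.
Proof.
split=> [|_ _ [h ->] [k ->]|_ _ [h ->] [k ->]] /=.
- by exists 1; rewrite rmorph1.
- by exists (h - k); rewrite rmorphB.
- by exists (h * k); rewrite rmorphM.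
Qed.

Lemma inv_ev_torsion x h : x != 0 -> x^-1 = ev x h -> exists2 m, (0 < m)%N & x ^+ m = 1.
Proof.
move=> x0 xh; pose q := 'X * h - 1.
have q0 : q != 0.
  apply: contraTneq isT => qE; have := congr1 (fun r : {poly 'F_p} => r`_0) qE.
  by rewrite coefB coefXM coef1 coef0 /= sub0r => /eqP; rewrite oppr_eq0 oner_eq0.
have evq : ev x q = 0 by rewrite rmorphB rmorphM rmorph1 /= evX -xh divff ?subrr.
have evXn i : x ^+ i = ev x ('X^i %% q).
  rewrite -[in LHS](evX x) -rmorphXn [in LHS](divp_eq 'X^i q) rmorphD rmorphM /= evq.
  by rewrite mulr0 add0r.
pose s := (size q).-1; pose r i : 'rV['F_p]_s := poly_rV ('X^i %% q).
have rE i : rVpoly (r i) = 'X^i %% q.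
  have : (size ('X^i %% q)%R < size q)%N by rewrite ltn_modp.
  by move=> lt; apply: poly_rV_K; rewrite /s -ltnS (ltn_predK lt).
pose r' (i : 'I_(#|{: 'rV['F_p]_s}|.+1)) := r i.
have /injectivePn[i [j ij rij]] : ~~ injectiveb r'.
  by apply/negP => /injectiveP/leq_card; rewrite card_ord ltnn.
have xij : x ^+ i = x ^+ j by rewrite !evXn -!rE -/(r' i) rij.
wlog lij : i j ij rij xij / (i < j)%N => [wl|].
  case: (ltngtP i j) => h'; [exact: (wl i j)|by apply: (wl j i) => //; rewrite eq_sym|].
  by case/negP: ij; apply/eqP/val_inj.
exists (j - i)%N; first by rewrite subn_gt0.
apply: (mulfI (expf_neq0 i x0)); rewrite -exprD subnKC ?(ltnW lij) // mulr1.
by rewrite xij.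
Qed.

Section Chart.
Variables (B : set K) (rB : subring B) (tot : forall y, B y \/ B y^-1).

Lemma natr_inR m : B m%:R.
Proof.
by elim: m => [|m IH]; [apply: subring0|rewrite mulrS; apply: subringD => //; apply: subring1].
Qed.

Lemma const_inR (a : 'F_p) : B (const_fun a%:P).
Proof. by rewrite -[a]natr_Zp polyC_natr rmorph_nat; apply: natr_inR. Qed.

Lemma const_isunit (a : 'F_p) : a != 0 -> isunit B (const_fun a%:P).
Proof.
move=> a0; split; rewrite ?const_fun_eq0 ?polyC_eq0 //; first exact: const_inR.
suff -> : (const_fun a%:P)^-1 = const_fun (a^-1)%:P by apply: const_inR.
apply: (mulfI (x := const_fun a%:P)); first by rewrite const_fun_eq0 polyC_eq0.
rewrite divff ?const_fun_eq0 ?polyC_eq0 // -rmorphM -polyCM divff //.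
by rewrite polyC1 rmorph1.
Qed.

Lemma const_funE (f : {poly 'F_p}) n : (size f <= n)%N ->
  const_fun f = \sum_(i < n) const_fun (f`_i)%:P * const_fun 'X ^+ i.
Proof.
move=> fn; rewrite {1}(_ : f = \poly_(i < n) f`_i).
  by rewrite poly_def rmorph_sum; apply: eq_bigr => i _; rewrite -mul_polyC rmorphM rmorphXn.
by apply/polyP => i; rewrite coef_poly; case: ltnP => // ni; rewrite nth_default // (leq_trans fn).
Qed.

Definition uniformizer_on_base (pi : K) := [/\ B pi, ~ B pi^-1 &
  forall g, g != 0 -> exists k : int, assoc B (const_fun g) (pi ^ k)].

Lemma isunit_addr u z : isunit B u -> B z -> ~ isunit B z -> isunit B (u + z).
Proof.
move=> Uu Bz nz; have [u0 Bu BVu] := Uu.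
have := @isunit_add _ _ rB tot (u + z) (- z) (subringD rB Bu Bz) (subringN rB Bz).
rewrite addrK => /(_ Uu)[//|[z0 _ BVz]]; case: nz; split=> //.
  by rewrite -oppr_eq0.
by rewrite -[z]opprK invrN; apply: subringN.
Qed.

Lemma not_unit_mul (z w : K) : B z -> B w -> ~ B z^-1 -> ~ isunit B (z * w).
Proof. by move=> Bz Bw BVz /(isunit_factor rB Bz Bw)[]. Qed.

Lemma uniformizer_infinite : ~ B (const_fun 'X) -> exists pi, uniformizer_on_base pi.
Proof.
set t := const_fun 'X => Bt.
have t0 : t != 0 by rewrite const_fun_eq0 polyX_eq0.
have Bti : B t^-1 by case: (tot t).
have inB (h : {poly 'F_p}) n : (size h <= n.+1)%N -> B (const_fun h * t^-1 ^+ n).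
  move=> hn; rewrite (const_funE hn) mulr_suml; apply: subring_sum => // i _.
  rewrite -mulrA -/t; apply: subringM => //; first exact: const_inR.
  have -> : t^-1 ^+ n = t^-1 ^+ i * t^-1 ^+ (n - i) by rewrite -exprD subnKC // -ltnS.
  rewrite mulrA -exprMn divff // expr1n mul1r.
  exact: subringX.
exists t^-1; split=> //; first by rewrite invrK.
move=> g g0; have [n gn] : exists n, size g = n.+1.
  by exists (size g).-1; rewrite prednK // lt0n size_poly_eq0.
exists (- n%:Z); rewrite /assoc invr_expz opprK -exprnP.
have gE : g = (lead_coef g) *: 'X^n + (\poly_(i < n) g`_i).
  apply/polyP => i; rewrite coefD coefZ coefXn coef_poly lead_coefE gn /=.
  case: ltngtP => [||->]; rewrite ?mulr0 ?add0r ?mulr1 ?addr0 //.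
  by move=> ni; rewrite nth_default // gn.
rewrite {1}gE rmorphD mulrDl -mul_polyC rmorphM rmorphXn /= -/t.
rewrite -mulrA -exprMn divff // expr1n mulr1.
have U : isunit B (const_fun (lead_coef g)%:P) by apply: const_isunit; rewrite lead_coef_eq0.
case: n {gn gE} => [|n] in gn gE *.
  by rewrite poly_def big_ord0 rmorph0 mul0r addr0.
have Bh := inB (\poly_(i < n.+1) g`_i) n (size_poly _ _).
rewrite exprSr mulrA; apply: isunit_addr => //; first exact: subringM.
by rewrite mulrC; apply: not_unit_mul => //; rewrite invrK.
Qed.

Lemma uniformizer_finite f : B (const_fun 'X) -> f != 0 -> ~ B (const_fun f)^-1 ->
  exists pi, uniformizer_on_base pi.
Proof.
move=> Bt f0 fB.
have BJ h : B (const_fun h).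
  rewrite (const_funE (leqnn _)); apply: subring_sum => // i _.
  by apply: subringM => //; [apply: const_inR|apply: subringX].
pose P m := `[< exists f : {poly 'F_p}, [/\ f != 0, size f = m & ~ B (const_fun f)^-1] >].
have exP : exists m, P m by exists (size f); apply/asboolP; exists f.
have [m /asboolP[q [q0 qm qB]] minm] := ex_minnP exP.
have small h : h != 0 -> (size h < m)%N -> isunit B (const_fun h).
  move=> h0 hm; split; rewrite ?const_fun_eq0 //; apply: contrapT => hB.
  by have := minm (size h); rewrite leqNgt hm => /(_ _)/negP[] //; apply/asboolP; exists h.
have q1 : (1 < size q)%N.
  rewrite ltnNge; apply/negP => /size1_polyC qc; apply: qB; rewrite qc.
  by case: (const_isunit (a := q`_0)) => //; apply: contraNneq q0 => q00; rewrite qc q00.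
exists (const_fun q); split=> // g.
have [n] := ubnP (size g); elim: n g => // n IH g; rewrite ltnS => gn g0.
have gE := divp_eq g q; have [r0|r0] := eqVneq (g %% q) 0.
  rewrite r0 addr0 in gE.
  have h0 : g %/ q != 0 by apply: contraNneq g0 => h0; rewrite gE h0 mul0r.
  have [|k hk] := IH (g %/ q) _ h0.
    have : (0 < size g)%N by rewrite size_poly_gt0.
    rewrite size_divp //; move: gn q1; move: (size g) (size q) => a b.
    by lia.
  exists (k + 1); rewrite gE rmorphM expfzDr ?const_fun_eq0 // expr1z /assoc invfM mulrACA.
  by apply: isunitM => //; apply: assoc_refl; rewrite ?const_fun_eq0.
exists 0; rewrite expr0z /assoc divr1 gE rmorphD addrC; apply: isunit_addr => //.
  by apply: small => //; rewrite -qm ltn_modp.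
by rewrite mulrC rmorphM; apply: not_unit_mul.
Qed.

Lemma uniformizer_exists x : x != 0 -> B x -> ~ B x^-1 ->
  exists pi, uniformizer_on_base pi.
Proof.
move=> x0 Bx BVx; case: (EM (B (const_fun 'X))) => Bt; last exact: uniformizer_infinite.
suff [f f0 fB] : exists2 f, f != 0 & ~ B (const_fun f)^-1 by apply: uniformizer_finite fB.
apply: contrapT => nof; apply: BVx.
have BJ h : B (const_fun h).
  rewrite (const_funE (leqnn _)); apply: subring_sum => // i _.
  by apply: subringM => //; [apply: const_inR|apply: subringX].
have Bbase (c : Fpt p) : B c%:A.
  have [a [b [b0 ->]]] := const_fun_frac c; apply: subringM => //.
  by apply: contrapT => bB; apply: nof; exists b.
have /Fadjoin_polyP[h /polyOverP hB ->] : x^-1 \in <<1; x>>%VS.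
  by rewrite memvV; apply: memv_adjoin.
apply: subring_horner => // i; have /vlineP[c ->] := hB i; exact: Bbase.
Qed.

Lemma power_of_uniformizer pi y : uniformizer_on_base pi -> y != 0 ->
  exists2 m, (0 < m <= \dim {:K})%N & exists k : int, assoc B (y ^+ m) (pi ^ k).
Proof.
move=> [Bpi BVpi piP] y0.
have pi0 : pi != 0 by apply/eqP => e; apply: BVpi; rewrite e invr0; apply: subring0.
have chart (c : Fpt p) : c%:A != 0 :> K -> exists k : int, assoc B (c%:A : K) (pi ^ k).
  have [a [b [b0 ->]]] := const_fun_frac c => ab0.
  have a0 : a != 0 by apply: contraNneq ab0 => ->; rewrite rmorph0 mul0r.
  have [k1 h1] := piP a a0; have [k2 h2] := piP b b0.
  exists (k1 - k2); rewrite /assoc expfzDr // -invr_expz.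
  rewrite (_ : _ / _ = const_fun a / pi ^ k1 * (const_fun b / pi ^ k2)^-1).
    by apply: isunitM => //; apply: isunitV.
  by field; rewrite const_fun_eq0 b0 !expfz_neq0.
pose f := minPoly 1%VS y; pose n := adjoin_degree 1%VS y.
have fn : size f = n.+1 := size_minPoly _ _.
have nK : (n <= \dim {:K})%N.
  have <- : \dim <<1; y>> = n by rewrite dim_Fadjoin dimv1 muln1.
  exact/dimvS/subvf.
have fB i : f`_i != 0 -> exists k : int, assoc B f`_i (pi ^ k).
  by have /polyOverP/(_ i)/vlineP[c ->] := minPolyOver 1%AS y; apply: chart.
have fy : \sum_(i < n.+1) f`_i * y ^+ i = 0.
  by rewrite -fn -horner_coef; apply/rootP/root_minPoly.
apply: contrapT => nom.
case: (@assoc_sum _ B rB tot n.+1 (fun i => f`_i * y ^+ i)).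
- move=> i j ij; rewrite !mulf_eq0 !negb_or => /andP[+ _] /andP[+ _].
  move=> fi0 fj0 aij; apply: nom.
  exists (j - i)%N; first by lia.
  have [ki hi] := fB i fi0; have [kj hj] := fB j fj0; exists (ki - kj).
  rewrite /assoc expfzDr // -invr_expz.
  have -> : y ^+ (j - i) / (pi ^ ki / pi ^ kj) =
     (f`_i * y ^+ i / (f`_j * y ^+ j))^-1 * (f`_i / pi ^ ki) * (f`_j / pi ^ kj)^-1.
    have -> : y ^+ j = y ^+ i * y ^+ (j - i) by rewrite -exprD subnKC //; lia.
    by field; rewrite fi0 fj0 !expfz_neq0 // !expf_neq0.
  by do ?[apply: isunitM => //]; apply: isunitV.
- move=> /(_ n (ltnSn n))/eqP; rewrite mulf_eq0 expf_eq0 (negPf y0) andbF orbF.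
  by have := monic_minPoly 1%VS y; rewrite monicE lead_coefE fn /= => /eqP ->; rewrite oner_eq0.
- by case=> i [_ _]; rewrite fy => -[]; rewrite mul0r eqxx.
Qed.

End Chart.

Lemma places_exist (x : K) : x != 0 ->
  (exists2 m, (0 < m)%N & x ^+ m = 1) \/ exists v : dval K, 0 < v x.
Proof.
move=> x0; case: (EM (exists h, x^-1 = ev x h)) => [[h xh]|xh].
  by left; apply: inv_ev_torsion xh.
right; have [B [rB AB BVx maxB]] := maximal_subring (ev_subring x) xh.
have Bx : B x by apply: AB; exists 'X; rewrite evX.
have tot := maximal_valuation_ring rB Bx BVx maxB.
have [pi upi] := uniformizer_exists rB tot x0 Bx BVx.
have [Bpi BVpi _] := upi.
pose N := (\dim {:K})`!.
have disc y : y != 0 -> exists k : int, assoc B (y ^+ N) (pi ^ k).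
  move=> y0; have [m /andP[m0 mK] [k ymk]] := power_of_uniformizer rB tot upi y0.
  have /dvdnP[q Nq] : (m %| N)%N by apply: dvdn_fact; rewrite m0.
  exists (k * q); rewrite Nq mulnC exprM -exprz_exp /assoc -exprVn -exprMn.
  exact: isunitX.
have [v vP] := discrete_valuation rB tot Bpi BVpi (fact_gt0 _) disc.
by exists v; apply: vP.
Qed.

End FunctionField.

(** * Cycles *)

Section Cycle.
Variables (K : fieldType) (d : nat) (F G : {poly K}) (P : K * K) (n : nat).
Local Notation pt i := (iter i (phi d F G) P).
Hypotheses (d_gt0 : (0 < d)%N) (res_neq0 : hres d F G != 0)
  (P_neq0 : P != (0, 0)) (n_gt1 : (1 < n)%N) (per : peq (pt n) P)
  (min_per : forall k, (0 < k < n)%N -> ~~ peq (pt k) P).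

Lemma iter_neq0 i : pt i != (0, 0).
Proof. by elim: i => //= i; apply: phi_neq0. Qed.

Lemma peq_trans (A B C : K * K) : A != (0, 0) -> B != (0, 0) -> C != (0, 0) ->
  peq A B -> peq B C -> peq A C.
Proof.
move=> A0 B0 C0 /(peq_scale A0 B0)[a a0 ->] /(peq_scale (scale_neq0 a0 A0) C0)[b _ ->].
by rewrite /peq /=; apply/eqP; ring.
Qed.

Lemma peq_iterD i j k : peq (pt i) (pt j) -> peq (pt (k + i)) (pt (k + j)).
Proof. by move=> ij; elim: k => //= k; apply: phi_peq; apply: iter_neq0. Qed.

Lemma peq_iter_per i : peq (pt (i + n)) (pt i).
Proof. by have := @peq_iterD n 0 i per; rewrite addn0. Qed.

Lemma peq_iter_perM i m : peq (pt (i + m * n)) (pt i).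
Proof.
elim: m => [|m IH]; first by rewrite addn0 peq_refl.
apply: (peq_trans _ _ _ _ IH); rewrite ?iter_neq0 //.
by rewrite mulSn addnCA addnC; apply: peq_iter_per.
Qed.

Lemma peq_iterP i k : peq (pt i) (pt (i + k)) = (n %| k)%N.
Proof.
apply/idP/idP => [|/dvdnP[m ->]]; last by rewrite peq_sym peq_iter_perM.
move=> /(peq_iterD (i * n.-1)%N) h.
apply: contraT => nk.
have e : (i * n.-1 + i = i * n)%N by nia.
have /negP[] : ~~ peq (pt (k %% n)) P.
  by apply: min_per; rewrite lt0n -/(dvdn _ _) nk ltn_mod; lia.
have h1 : peq (pt (i * n)) P := peq_iter_perM 0 i.
have h2 : peq (pt (k + i * n)) (pt k) := peq_iter_perM k i.
have h3 : peq (pt k) (pt (k %% n)).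
  by rewrite {1}(divn_eq k n) addnC; apply: peq_iter_perM.
move: h; rewrite addnA e addnC => h.
have T A B C := @peq_trans A B C.
have h4 : peq (pt (k + i * n)) P.
  apply: peq_trans h1; rewrite ?iter_neq0 // peq_sym; exact: h.
apply: peq_trans h4; rewrite ?iter_neq0 // peq_sym.
by apply: peq_trans h3; rewrite ?iter_neq0.
Qed.

Lemma delta_shift v i j : good_red v d F G -> ~~ peq (pt i) (pt j) ->
  delta v (pt i.+1) (pt j.+1) = delta v (pt i) (pt j).
Proof.
move=> gv ij.
have ijk k : ~~ peq (pt (k + i)) (pt (k + j)).
  wlog lij : i j ij / (i <= j)%N => [wl|].
    case/orP: (leq_total i j) => ?; first exact: wl.
    by rewrite peq_sym wl // peq_sym.
  by move: ij; rewrite -(subnKC lij) addnA !peq_iterP.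
have le k : delta v (pt (k + i)) (pt (k + j)) <= delta v (pt (k.+1 + i)) (pt (k.+1 + j)).
  by apply: delta_phi_le; rewrite ?iter_neq0 //; exact: (ijk k.+1).
apply/eqP; rewrite eq_le [X in _ && X](le 0%N) andbT.
have -> : delta v (pt i) (pt j) = delta v (pt (n + i)) (pt (n + j)).
  symmetry; apply: delta_peq; rewrite ?iter_neq0 // peq_sym addnC; exact: peq_iter_per.
rewrite -[i.+1]add1n -[j.+1]add1n.
rewrite -(ltn_predK n_gt1); elim: n.-1 => // m IH.
exact: le_trans IH (le _).
Qed.

Definition dist v k := delta v P (pt k).

Lemma delta_dist v i k : good_red v d F G -> ~~ (n %| k)%N ->
  delta v (pt i) (pt (i + k)) = dist v k.
Proof.
by move=> gv nk; elim: i => // i <-; rewrite addSn delta_shift ?peq_iterP.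
Qed.

Lemma dist_opp v : good_red v d F G -> dist v n.-1 = dist v 1.
Proof.
move=> gv; have n1 : ~~ (n %| 1)%N by rewrite dvdn1; lia.
have nn : ~~ (n %| n.-1)%N by apply/negP => /dvdn_leq; lia.
rewrite -(delta_dist n.-1 gv n1) addn1 prednK; last lia.
rewrite deltaC /dist; apply: delta_peq; rewrite ?iter_neq0 ?peq_refl //.
by rewrite peq_sym -{2}(ltn_predK n_gt1) -addn1 peq_iterP.
Qed.

Hypothesis places : forall x : K, x != 0 ->
  (exists2 m, (0 < m)%N & x ^+ m = 1) \/ exists v : dval K, 0 < v x.
Hypothesis one_bad : forall v w : dval K,
  ~ good_red v d F G -> ~ good_red w d F G -> v =1 w.

Lemma val0_of_good x : (forall v, good_red v d F G -> v x = 0) ->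
  forall v : dval K, v x = 0.
Proof.
move=> gx v; have [->|x0] := eqVneq x 0; first exact: dv0.
have xV0 : x^-1 != 0 by rewrite invr_eq0.
case: (places x0) => [[m m0 /torsion_val0 ->]//|[u ux]].
case: (places xV0) => [[m m0 /torsion_val0 h]|[w wx]].
  by apply: oppr_inj; rewrite -valV h // oppr0.
have bad (u' : dval K) : u' x != 0 -> ~ good_red u' d F G by move=> /eqP h /gx.
move: wx; rewrite valV => wx.
have bu : ~ good_red u d F G by apply: bad; lia.
have bw : ~ good_red w d F G by apply: bad; lia.
by have := one_bad bu bw x; lia.
Qed.

Lemma val0_of_ge0 x : (forall v : dval K, 0 <= v x) -> forall v : dval K, v x = 0.
Proof.
move=> xR v; have [->|x0] := eqVneq x 0; first exact: dv0.
have xV0 : x^-1 != 0 by rewrite invr_eq0.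
case: (places xV0) => [[m m0 /torsion_val0 h]|[w]].
  by apply: oppr_inj; rewrite -valV h // oppr0.
by rewrite valV; have := xR w; lia.
Qed.

Definition bracket i j := brk (pt i) (pt j).
Local Notation b := bracket.

Definition edge_ratio i := b i i.+1 / b i i.+2.
Definition cross_ratio k := (b k k.+1 * b k.+2 k.+3) / (b k k.+2 * b k.+1 k.+3).
Definition continuant k := b 0 k.+1 / b 0 1 * \prod_(i < k) edge_ratio i.

Hypothesis n_gt2 : (2 < n)%N.

Lemma brk_iter_neq0 i k : (0 < k < n)%N -> b i (i + k)%N != 0.
Proof.
move=> k0; rewrite /bracket -peqE peq_iterP; apply/negP => /dvdn_leq; lia.
Qed.

Lemma brk1_neq0 i : b i i.+1 != 0.
Proof. by rewrite -addn1; apply: brk_iter_neq0; lia. Qed.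

Lemma brk2_neq0 i : b i i.+2 != 0.
Proof. by rewrite -addn2; apply: brk_iter_neq0; lia. Qed.

(* The Pluecker relation among the points 0, k+1, k+2, k+3. *)
Lemma continuant_rec k :
  continuant k.+2 = continuant k.+1 - cross_ratio k * continuant k.
Proof.
rewrite /continuant !big_ord_recr /=; set p := \prod_(i < k) _.
have pl : b 0 k.+3 =
    (b 0 k.+2 * b k.+1 k.+3 - b 0 k.+1 * b k.+2 k.+3) / b k.+1 k.+2.
  by apply: (canRL (mulfK (brk1_neq0 _))); rewrite /bracket /brk; ring.
rewrite pl /edge_ratio /cross_ratio; field.
by rewrite !brk1_neq0 !brk2_neq0.
Qed.

Lemma continuant0 : continuant 0 = 1.
Proof. by rewrite /continuant big_ord0 mulr1 divff ?(brk1_neq0 0). Qed.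

Lemma continuant1 : continuant 1 = 1.
Proof.
rewrite /continuant big_ord1 /edge_ratio.
by have := brk1_neq0 0; have := brk2_neq0 0 => /= ? ?; field; apply/andP.
Qed.

Section GoodPlace.
Variable v : dval K.
Hypothesis gv : good_red v d F G.

Lemma val_brk i k : ~~ (n %| k)%N ->
  v (b i (i + k)%N) = dist v k + minv v (pt i) + minv v (pt (i + k)).
Proof. by move=> nk; rewrite -(delta_dist i gv nk) /delta -/(brk _ _) /bracket; lia. Qed.

Lemma val_brk1 i : v (b i i.+1) = dist v 1 + minv v (pt i) + minv v (pt i.+1).
Proof. by rewrite -addn1 val_brk //; apply/negP => /dvdn_leq; lia. Qed.

Lemma val_brk2 i : v (b i i.+2) = dist v 2 + minv v (pt i) + minv v (pt i.+2).
Proof. by rewrite -addn2 val_brk //; apply/negP => /dvdn_leq; lia. Qed.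

Lemma edge_ratio_neq0 i : edge_ratio i != 0.
Proof. by rewrite mulf_neq0 ?invr_eq0 ?brk1_neq0 ?brk2_neq0. Qed.

Lemma val_edge_ratio i : v (edge_ratio i) =
  dist v 1 - dist v 2 + minv v (pt i.+1) - minv v (pt i.+2).
Proof.
rewrite dvM ?invr_eq0 ?brk1_neq0 ?brk2_neq0 // valV val_brk1 val_brk2; lia.
Qed.

Lemma val_cross_ratio k : v (cross_ratio k) = (dist v 1 - dist v 2) *+ 2.
Proof.
rewrite /cross_ratio !(dvM, valV) ?mulf_neq0 ?invr_eq0 ?mulf_neq0 ?brk1_neq0 ?brk2_neq0 //.
by rewrite !val_brk1 !val_brk2; lia.
Qed.

Lemma val_continuant k : ~~ (n %| k.+1)%N ->
  v (continuant k) = dist v k.+1 - dist v 1 + (dist v 1 - dist v 2) *+ k.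
Proof.
move=> nk; have bk : b 0 k.+1 != 0 by rewrite /bracket -peqE (peq_iterP 0 k.+1).
have ek : \prod_(i < k) edge_ratio i != 0 by apply/prodf_neq0 => i _; apply: edge_ratio_neq0.
rewrite /continuant !(dvM, valV) ?mulf_neq0 ?invr_eq0 ?(brk1_neq0 0) //.
rewrite (val_brk 0 nk) (val_brk1 0) val_prod ?edge_ratio_neq0 //; last first.
  exact: edge_ratio_neq0.
under eq_bigr do rewrite val_edge_ratio.
have sumE (mu : nat -> int) e :
    \sum_(i < k) (e + mu i.+1 - mu i.+2) = e *+ k + mu 1%N - mu k.+1.
  elim: k {nk bk ek} => [|k IH]; first by rewrite big_ord0; lia.
  by rewrite big_ord_recr /= IH; lia.
rewrite (sumE (fun i => minv v (pt i))) add0n; set e := _ *+ k; lia.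
Qed.
End GoodPlace.


Lemma cross_ratio_neq0 k : cross_ratio k != 0.
Proof. by rewrite !mulf_neq0 ?invr_eq0 ?mulf_neq0 ?brk1_neq0 ?brk2_neq0. Qed.

Lemma val_cross_ratio_const (v : dval K) k : v (cross_ratio k) = v (cross_ratio 0).
Proof.
apply/eqP; rewrite -subr_eq0 -valV -dvM ?invr_eq0 ?cross_ratio_neq0 //; apply/eqP.
move: v; apply: val0_of_good => v gv.
by rewrite dvM ?invr_eq0 ?cross_ratio_neq0 // valV !val_cross_ratio // subrr.
Qed.

Lemma inMax_cross_ratio_continuant (v : dval K) k : 0 < v (cross_ratio 0) ->
  inMax v (continuant k - 1).
Proof.
move=> v0.
suff /(_ k)[] : forall k, inMax v (continuant k - 1) /\ inMax v (continuant k.+1 - 1) by [].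
elim=> [|{}k [IH1 IH2]].
  by rewrite continuant0 continuant1 subrr /inMax eqxx.
split=> //; rewrite continuant_rec addrAC inMaxD // -mulrN mulrC inMaxM //.
  rewrite rpredN -[continuant k](subrK 1) rpredD ?rpred1 //; exact: inMaxW.
by rewrite /inMax val_cross_ratio_const v0 orbT.
Qed.

Lemma continuant_neq0 k : ~~ (n %| k.+1)%N -> continuant k != 0.
Proof.
move=> nk; rewrite !mulf_neq0 ?invr_eq0 ?(brk1_neq0 0) //.
  by rewrite /bracket -peqE (peq_iterP 0 k.+1).
by apply/prodf_neq0 => i _; apply: edge_ratio_neq0.
Qed.

Lemma val_cross_ratio_le0 (v : dval K) : v (cross_ratio 0) <= 0.
Proof.
rewrite leNgt; apply/negP => v0.
have nn : ~~ (n %| (n - 2).+1)%N by apply/negP => /dvdn_leq; lia.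
have cn0 := continuant_neq0 nn.
have /unitR_near1/unitRP[_ vc] := inMax_cross_ratio_continuant (n - 2) v0.
have r0 := cross_ratio_neq0 0.
have : v (continuant (n - 2) ^+ 2 / cross_ratio 0 ^+ (n - 2)) = 0.
  move: v {v0 vc}; apply: val0_of_good => v gv.
  rewrite dvM ?invr_eq0 ?expf_neq0 // valV !valX val_continuant //.
  rewrite val_cross_ratio // (_ : (n - 2).+1 = n.-1); last by lia.
  by rewrite dist_opp // subrr add0r mulrnAC subrr.
rewrite dvM ?invr_eq0 ?expf_neq0 // valV !valX vc.
by nia.
Qed.

Lemma val_cross_ratio0 (v : dval K) k : v (cross_ratio k) = 0.
Proof.
rewrite val_cross_ratio_const -[LHS]opprK -valV (val0_of_ge0 _ v) ?oppr0 // => w.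
by rewrite valV oppr_ge0 val_cross_ratio_le0.
Qed.

Lemma continuant_inR (v : dval K) k : continuant k \in inR v.
Proof.
suff /(_ k)[] : forall k, continuant k \in inR v /\ continuant k.+1 \in inR v by [].
elim=> [|{}k [IH1 IH2]]; first by rewrite continuant0 continuant1 rpred1.
split=> //; rewrite continuant_rec rpredB //; apply: rpredM => //.
by rewrite -topredE /= /inR val_cross_ratio0 lexx orbT.
Qed.

Lemma val_continuant0 (v : dval K) k : v (continuant k) = 0.
Proof.
move: v; apply: val0_of_ge0 => v; have := continuant_inR v k.
by rewrite -topredE => /orP[/eqP->|//]; rewrite (dv0 v).
Qed.

Lemma dist_const v k : good_red v d F G -> ~~ (n %| k)%N -> dist v k = dist v 1.
Proof.
case: k => [|k] gv nk; first by rewrite dvdn0 in nk.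
have := val_continuant gv nk; rewrite val_continuant0.
have := val_cross_ratio gv 0; rewrite val_cross_ratio0.
move=> e; have -> : dist v 1 - dist v 2 = 0 by lia.
by rewrite mul0rn; lia.
Qed.

End Cycle.

Theorem cycle_equidistant (K : fieldType) (d : nat) (F G : {poly K}) (P : K * K)
    (n : nat) :
  (0 < d)%N -> hres d F G != 0 ->
  P != (0, 0) -> (1 < n)%N -> peq (iter n (phi d F G) P) P ->
  (forall k, (0 < k < n)%N -> ~~ peq (iter k (phi d F G) P) P) ->
  (forall x : K, x != 0 ->
    (exists2 m, (0 < m)%N & x ^+ m = 1) \/ exists v : dval K, 0 < v x) ->
  (forall v w : dval K, ~ good_red v d F G -> ~ good_red w d F G -> v =1 w) ->
  forall (v : dval K) i j, good_red v d F G ->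
    ~~ peq (iter i (phi d F G) P) (iter j (phi d F G) P) ->
    delta v (iter i (phi d F G) P) (iter j (phi d F G) P)
    = delta v P (phi d F G P).
Proof.
move=> d0 res0 P0 n1 per min_per places one_bad v i j gv.
wlog ij : i j / (i <= j)%N => [wl|].
  by case/orP: (leq_total i j) => ij; [exact: wl|rewrite peq_sym deltaC; exact: wl].
rewrite -(subnKC ij) (peq_iterP d0 res0 P0 n1 per min_per) => nk.
rewrite (delta_dist d0 res0 P0 n1 per min_per) //; set k := (j - i)%N in nk *.
have [n2|n2] := ltnP 2 n.
  exact: (dist_const d0 res0 P0 n1 per min_per places one_bad n2 gv nk).
have n2E : n = 2 by lia. have Z := iter_neq0 d0 res0 P0. subst n.
have k1 : ~~ peq P (iter 1 (phi d F G) P) by rewrite (peq_iterP d0 res0 P0 n1 per min_per 0 1).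
rewrite /dist (_ : k = 1 + k./2 * 2)%N; last first.
  by move: nk; rewrite dvdn2 negbK => ko; rewrite -[LHS]odd_double_half ko muln2.
apply: (delta_peq v (Z 0%N) (Z 1%N)) => //; first exact: peq_refl.
by rewrite peq_sym; apply: (peq_iter_perM d0 res0 P0 per).
Qed.

Theorem theorem5p1 (p : nat) (K : fieldExtType (Fpt p)) (d : nat)
    (F G : {poly K}) (P : K * K) (n : nat) :
  prime p ->
  (0 < d)%N -> (size F <= d.+1)%N -> (size G <= d.+1)%N ->
  hres d F G != 0 ->
  (* exactly one prime of bad reduction *)
  (exists v0 : dval K, ~ good_red v0 d F G /\
     forall w : dval K, ~ good_red w d F G -> forall x, w x = v0 x) ->
  (* P is a periodic point whose cycle has length n > 1 *)
  P != (0, 0) -> (1 < n)%N ->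
  peq (iter n (phi d F G) P) P ->
  (forall k, (0 < k < n)%N -> ~~ peq (iter k (phi d F G) P) P) ->
  forall v : dval K, good_red v d F G ->
  forall i j k l : nat,
    ~~ peq (iter i (phi d F G) P) (iter j (phi d F G) P) ->
    ~~ peq (iter k (phi d F G) P) (iter l (phi d F G) P) ->
    delta v (iter i (phi d F G) P) (iter j (phi d F G) P)
    = delta v (iter k (phi d F G) P) (iter l (phi d F G) P).
Proof.
move=> _ d0 _ _ res0 [v0 [_ v0_only]] P0 n1 per min_per v gv i j k l ij kl.
have one_bad (u w : dval K) : ~ good_red u d F G -> ~ good_red w d F G -> u =1 w.
  by move=> bu bw x; rewrite (v0_only u bu) (v0_only w bw).
have E := cycle_equidistant d0 res0 P0 n1 per min_per (@places_exist p K) one_bad gv.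
by rewrite !E.
Qed.
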